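(* Let $n\ge 3$ be a prime number. Then every AG-groupoid in $Z_{AG}^{*}(n)$ is a $T^3$-AG-groupoid.
   Context: A groupoid is a set with a binary operation. For $t,u\in Z_n=\{0,1,\dots,n-1\}$, $Z_n(t,u)$ denotes the groupoid on $Z_n$ with operation $a\cdot b = ta+ub \pmod n$. An AG-groupoid is a groupoid $G$ satisfying $(ab)c=(cb)a$ for all $a,b,c\in G$. The class $Z_{AG}^{*}(n)$ consists of the AG-groupoids $Z_n(t,u)$ with $t,u\in Z_n\setminus\{0\}$, $t\ne u$ (not necessarily relatively prime) and $t^2\equiv u\pmod n$. An AG-groupoid $G$ is a $T_l^3$-AG-groupoid if for all $a,b,c\in G$, $ab=ac$ implies $ba=ca$; it is a $T_r^3$-AG-groupoid if for all $a,b,c\in G$, $ba=ca$ implies $ab=ac$; it is a $T^3$-AG-groupoid if it is both a $T_l^3$-AG-groupoid and a $T_r^3$-AG-groupoid. *)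

(* Defs.v *)
From mathcomp Require Import all_boot.

Set Implicit Arguments.
Unset Strict Implicit.
Unset Printing Implicit Defensive.

(* A groupoid (set with a binary operation) is given by its operation
   op : T -> T -> T on a carrier type T. *)

Definition AG_groupoid (T : Type) (op : T -> T -> T) : Prop :=
  forall a b c : T, op (op a b) c = op (op c b) a.

Definition Tl3_AG_groupoid (T : Type) (op : T -> T -> T) : Prop :=
  AG_groupoid op /\ forall a b c : T, op a b = op a c -> op b a = op c a.

Definition Tr3_AG_groupoid (T : Type) (op : T -> T -> T) : Prop :=
  AG_groupoid op /\ forall a b c : T, op b a = op c a -> op a b = op a c.

Definition T3_AG_groupoid (T : Type) (op : T -> T -> T) : Prop :=
  Tl3_AG_groupoid op /\ Tr3_AG_groupoid op.

(* An inhabitant of 'I_n shows that n is positive, so that reduction modulo n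
   lands in 'I_n for every n. *)
Lemma Zn_op_subproof (n : nat) (a : 'I_n) (m : nat) : m %% n < n.
Proof. by rewrite ltn_mod (leq_ltn_trans (leq0n a) (ltn_ord a)). Qed.

Definition Zn_op (n : nat) (t u a b : 'I_n) : 'I_n :=
  Ordinal (Zn_op_subproof a (t * a + u * b)).

Definition Z_AG_star (n : nat) (op : 'I_n -> 'I_n -> 'I_n) : Prop :=
  AG_groupoid op /\
  exists t u : 'I_n,
    [/\ t != 0 :> nat, u != 0 :> nat, t != u, t ^ 2 = u %[mod n]
      & op = Zn_op t u].

(* Main.v *)
Require Import Defs.
From mathcomp Require Import all_boot.

(** Modulo a prime [n], the nonzero coefficients [t] and [u] are invertible, so
    the operation [t * a + u * b] is injective in each of its two arguments.
    Hence [ab = ac] forces [b = c] ([Zn_op_injr]), after which [ba = ca] is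
    trivial; symmetrically [ba = ca] forces [b = c] ([Zn_op_injl]). *)

Lemma coprime_modMl_inj {n k : nat} {b c : 'I_n} :
  coprime n k -> k * b = k * c %[mod n] -> b = c.
Proof.
move=> co_nk; wlog le_cb : b c / c <= b.
  move=> main; have [/main // | /ltnW/main sym_main /esym/sym_main ->//] :=
    leqP c b.
move/eqP; rewrite eqn_mod_dvd ?leq_mul2l ?le_cb ?orbT // -mulnBr Gauss_dvdr //.
rewrite -eqn_mod_dvd // !modn_small ?ltn_ord // => /eqP.
exact: val_inj.
Qed.

Lemma prime_coprime_ord {n : nat} {k : 'I_n} :
  prime n -> k != 0 :> nat -> coprime n k.
Proof.
by move=> n_prime k_neq0; rewrite prime_coprime // gtnNdvd ?lt0n ?ltn_ord.
Qed.

Lemma Zn_op_injr {n : nat} {t u a : 'I_n} :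
  coprime n u -> injective (Zn_op t u a).
Proof.
move=> co_nu b c /(congr1 val) /= /eqP; rewrite eqn_modDl => /eqP.
exact: coprime_modMl_inj.
Qed.

Lemma Zn_op_injl {n : nat} {t u a : 'I_n} :
  coprime n t -> injective (Zn_op t u ^~ a).
Proof.
move=> co_nt b c /(congr1 val) /= /eqP; rewrite eqn_modDr => /eqP.
exact: coprime_modMl_inj.
Qed.

Theorem theorem3 (n : nat) (n_ge3 : 3 <= n) (n_prime : prime n)
    (op : 'I_n -> 'I_n -> 'I_n) (op_in : Z_AG_star op) :
  T3_AG_groupoid op.
Proof.
case: op_in => AG_op [t [u [t_neq0 u_neq0 _ _ def_op]]].
have co_nt := prime_coprime_ord n_prime t_neq0.
have co_nu := prime_coprime_ord n_prime u_neq0.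
split; split=> // a b c; rewrite def_op.
  by move/(Zn_op_injr co_nu) ->.
by move/(Zn_op_injl co_nt) ->.
Qed.
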